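(* Let $\mathrm{H}$ be a Hilbert space over $\mathbb{F} \in \{\mathbb{R}, \mathbb{C}\}$, let $d \geq 2$, let $\mathscr{A} \in \mathrm{H}^{n_1 \times \cdots \times n_d}$ with $\mathscr{A} \neq 0$, and let $I_k \subseteq [n_k]$, $k = 1, \ldots, d$, be nonempty index sets. Let $\mathscr{G} = \mathscr{A}(I_1, \ldots, I_d)$, let $R_k = \mathrm{rows}_k(\mathscr{A}, I_1, \ldots, I_d)$ for $k = 1, \ldots, d$, and let $\mathscr{B} = \mathrm{cross}_{\mathrm{T}}(\mathscr{A}, I_1, \ldots, I_d)$ be the Tucker-cross approximation of $\mathscr{A}$ at $(I_1, \ldots, I_d)$, i.e. $$\mathscr{B} = \mathscr{G} \times_1 \Big[ \big(G_{(1)}^{\top}\big)^{\dagger} R_1 \Big]^{\top} \times_2 \cdots \times_d \Big[ \big(G_{(d)}^{\top}\big)^{\dagger} R_d \Big]^{\top} \in \mathrm{H}^{n_1 \times \cdots \times n_d}.$$ Then: 1. $\mathscr{B}(I_1, \ldots, I_d) = \mathscr{G}$ and $\mathrm{rank}_{\mathrm{T}}(\mathscr{B}) = \mathrm{rank}_{\mathrm{T}}(\mathscr{G})$; 2. for each $k \in \{1, \ldots, d\}$, $\mathrm{rows}_k(\mathscr{B}, I_1, \ldots, I_d) = R_k$ if and only if $\mathrm{rank}_{\mathrm{r}}(G_{(k)}) = \mathrm{rank}_{\mathrm{c}}(R_k)$; 3. $\mathscr{B} = \mathscr{A}$ if and only if $\mathrm{rank}_{\mathrm{T}}(\mathscr{G})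 = \mathrm{rank}_{\mathrm{T}}(\mathscr{A})$.
   Context: Notation: $[n] = \{1, \ldots, n\}$. $\mathrm{H}^{n_1 \times \cdots \times n_d}$ is the set of $d$-dimensional arrays (function-valued tensors) with entries in $\mathrm{H}$; $\mathrm{H}^{m \times n}$ is the set of $m \times n$ matrices with entries in $\mathrm{H}$. A matrix over $\mathrm{H}$ can be transposed and multiplied on the left and on the right by matrices over $\mathbb{F}$ by the usual formulas. For $I_k \subseteq [n_k]$, $\mathscr{A}(I_1, \ldots, I_d)$ is the subtensor of $\mathscr{A}$ with mode-$k$ indices restricted to $I_k$; a colon in place of an index set means the full index range. Ranks of matrices over $\mathrm{H}$: the column-rank $\mathrm{rank}_{\mathrm{c}}(A)$ of $A \in \mathrm{H}^{m \times n}$ is the maximal number of its columns that are linearly independent over $\mathbb{F}$ as elements of $\mathrm{H}^m$; the row-rank $\mathrm{rank}_{\mathrm{r}}(A)$ is the column-rank of $A^{\top} \in \mathrm{H}^{n \times m}$. (These two need not be equal.) Adjoint, SVD, pseudoinverse: $\mathrm{H}^m$ carries the inner product $\langle b, a \rangle_{\ell_2(\mathrm{H})} = \sum_{i=1}^m \langle b(i), a(i) \rangle_{\mathrm{H}}$ (linear in the first argument). The adjoint of $A \in \mathrm{H}^{m \times n}$ is the linear operator $A^{*} : \mathrm{H}^m \to \mathbb{F}^n$, $A^{*} b = [\langle b, A(:,1) \rangle_{\ell_2(\mathrm{H})}, \ldots, \langle b, A(:,n) \rangle_{\ell_2(\mathrm{H})}]^{\top}$. Linear operators $\mathrm{H}^m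 \to \mathbb{F}^n$ are applied columnwise to matrices in $\mathrm{H}^{m \times k}$, giving matrices in $\mathbb{F}^{n \times k}$. A matrix $Q \in \mathrm{H}^{m \times n}$ has orthonormal columns if $Q^{*} Q$ is the identity matrix. Every nonzero $A \in \mathrm{H}^{m \times n}$ of column-rank $r$ admits an SVD $A = U \Sigma V^{*}$ with $U \in \mathrm{H}^{m \times r}$ having orthonormal columns, $\Sigma \in \mathbb{R}^{r \times r}$ diagonal with positive nonincreasing diagonal entries, and $V \in \mathbb{F}^{n \times r}$ having orthonormal columns. The pseudoinverse of $A$ is the linear operator $A^{\dagger} = V \Sigma^{-1} U^{*} : \mathrm{H}^m \to \mathbb{F}^n$, and $A^{\dagger} = 0$ if $A = 0$. Unfoldings: the mode-$k$ unfolding of $\mathscr{A} \in \mathrm{H}^{n_1 \times \cdots \times n_d}$ is the matrix $A_{(k)} \in \mathrm{H}^{n_k \times \prod_{l \neq k} n_l}$ with entries $A_{(k)}(i_k, \overline{i_1, \ldots, i_{k-1}, i_{k+1}, \ldots, i_d}) = \mathscr{A}(i_1, \ldots, i_d)$, where the overline denotes the long (lexicographic, big-endian) index; $[\,\cdot\,]_{(k)}$ also denotes the mode-$k$ unfolding, and $G_{(k)}$ is that of $\mathscr{G}$. Mode product: for $B_k \in \mathbb{F}^{m_k \times n_k}$, the mode-$k$ product $\mathscr{C} = \mathscr{A} \times_k B_k$ is the tensor over $\mathrm{H}$ whose mode-$k$ unfolding is $C_{(k)} = B_k A_{(k)}$. Tucker rank: $\mathrm{rank}_{\mathrm{T}}(\mathscr{A})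 = (\mathrm{rank}_{\mathrm{r}}(A_{(1)}), \ldots, \mathrm{rank}_{\mathrm{r}}(A_{(d)}))$. Row matrices: for any $\mathscr{A} \in \mathrm{H}^{n_1 \times \cdots \times n_d}$ and index sets $I_l \subseteq [n_l]$, $$\mathrm{rows}_k(\mathscr{A}, I_1, \ldots, I_d) = \big[ \mathscr{A}(I_1, \ldots, I_{k-1}, :, I_{k+1}, \ldots, I_d) \big]_{(k)}^{\top},$$ a matrix over $\mathrm{H}$ of size $\prod_{l \neq k} |I_l| \times n_k$. *)

(* Defs.v *)
From HB Require Import structures.
From mathcomp Require Import all_boot all_order all_algebra.
From mathcomp Require Import complex.
From mathcomp Require Import boolp classical_sets reals topology normedtype.

Set Implicit Arguments.
Unset Strict Implicit.
Unset Printing Implicit Defensive.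

Import Order.TTheory GRing.Theory Num.Theory.

Local Open Scope ring_scope.

Variant scalar_kind := RealScalars | ComplexScalars.

Definition scalar_field (R : realType) (f : scalar_kind) : numFieldType :=
  match f with RealScalars => R | ComplexScalars => R[i] end.

Definition of_real (R : realType) (f : scalar_kind) : R -> scalar_field R f :=
  match f with RealScalars => id | ComplexScalars => fun x => x%:C%C end.

Definition conj_scalar (R : realType) (f : scalar_kind) :
    scalar_field R f -> scalar_field R f :=
  match f with RealScalars => id | ComplexScalars => @conjc R end.

Section Matrices.
Variables (F : numFieldType) (H : lmodType F).

Definition lmulmx p m n (B : 'M[F]_(p, m)) (A : 'M[H]_(m, n)) : 'M[H]_(p, n) :=
  \matrix_(i, j) \sum_k B i k *: A k j.

Definition rmulmx m n p (A : 'M[H]_(m, n)) (B : 'M[F]_(n, p)) : 'M[H]_(m, p) :=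
  \matrix_(i, j) \sum_k B k j *: A i k.

(* The columns of A with indices in J are linearly independent over F. *)
Definition free_cols m n (A : 'M[H]_(m, n)) (J : {set 'I_n}) : Prop :=
  forall c : 'I_n -> F,
    (forall i, \sum_(j in J) c j *: A i j = 0) -> forall j, j \in J -> c j = 0.

Definition col_rank m n (A : 'M[H]_(m, n)) : nat :=
  (\max_(J : {set 'I_n} | `[< free_cols A J >]) #|J|)%N.

Definition row_rank m n (A : 'M[H]_(m, n)) : nat := col_rank A^T.

Definition colwise m n k (L : 'cV[H]_m -> 'cV[F]_n) (B : 'M[H]_(m, k)) :
    'M[F]_(n, k) :=
  \matrix_(i, j) L (col j B) i 0.

End Matrices.

Section Adjoint.
Variables (R : realType) (f : scalar_kind).
Local Notation F := (scalar_field R f).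
Variables (H : completeNormedModType F) (ip : H -> H -> F).

Definition ell2 m (b a : 'cV[H]_m) : F := \sum_i ip (b i 0) (a i 0).

Definition adjoint m n (A : 'M[H]_(m, n)) (b : 'cV[H]_m) : 'cV[F]_n :=
  \col_j ell2 b (col j A).

(* Conjugate transpose of a matrix over F. *)
Definition adj_scalar m n (V : 'M[F]_(m, n)) : 'M[F]_(n, m) :=
  map_mx (@conj_scalar R f) V^T.

Definition real_diag r (s : 'rV[R]_r) : 'M[F]_r :=
  diag_mx (map_mx (@of_real R f) s).

Definition is_svd m n r (A : 'M[H]_(m, n))
    (U : 'M[H]_(m, r)) (s : 'rV[R]_r) (V : 'M[F]_(n, r)) : Prop :=
  [/\ colwise (adjoint U) U = 1%:M,
      forall i, 0 < s 0 i,
      forall i j : 'I_r, (i <= j)%N -> s 0 j <= s 0 i,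
      adj_scalar V *m V = 1%:M
    & A = rmulmx (rmulmx U (real_diag s)) (adj_scalar V)].

(* The choice of the SVD does not affect the operator; the default value of
   xget is irrelevant because every nonzero matrix has an SVD. *)
Definition pinv m n (A : 'M[H]_(m, n)) : 'cV[H]_m -> 'cV[F]_n :=
  if A == 0 then fun=> 0 else
  let r := col_rank A in
  let usv : 'M[H]_(m, r) * 'rV[R]_r * 'M[F]_(n, r) :=
    xget (0, 0, 0) [set usv | is_svd A usv.1.1 usv.1.2 usv.2]%classic in
  fun b => usv.2 *m real_diag (map_mx GRing.inv usv.1.2) *m adjoint usv.1.1 b.

End Adjoint.

(* Modes and indices are numbered from 0. *)
Definition midx d (n : 'I_d -> nat) := {dffun forall k, 'I_(n k)}.

Definition tensor (T : Type) d (n : 'I_d -> nat) := {ffun midx n -> T}.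

(* Long index of the modes other than k; big-endian, evaluated by Horner's
   scheme: (... (i_1 * n_2 + i_2) * n_3 + ...) * n_d + i_d, skipping mode k. *)
Definition long_nat d (n : 'I_d -> nat) (k : 'I_d) (i : midx n) : nat :=
  foldl (fun a l => a * n l + i l)%N 0%N [seq l <- enum 'I_d | l != k].

Lemma long_nat_lt d (n : 'I_d -> nat) (k : 'I_d) (i : midx n) :
  (long_nat k i < \prod_(l | l != k) n l)%N.
Proof.
have -> : (\prod_(l | l != k) n l =
           \prod_(l <- [seq l <- enum 'I_d | l != k]) n l)%N.
  by rewrite big_filter big_enum_cond; apply: eq_bigl.
suff lt_foldl s a : (foldl (fun a l => a * n l + i l) a s <
                      a.+1 * \prod_(l <- s) n l)%N.
  by apply: leq_trans (lt_foldl _ _) _; rewrite mul1n.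
elim: s a => [|l s IHs] a /=; first by rewrite big_nil muln1.
rewrite big_cons mulnA; apply: leq_trans (IHs _) _.
by rewrite leq_mul2r mulSn addnC ltn_add2r ltn_ord orbT.
Qed.

Definition long_index d (n : 'I_d -> nat) (k : 'I_d) (i : midx n) :
    'I_(\prod_(l | l != k) n l) := Ordinal (long_nat_lt k i).

Lemma long_index_inj d (n : 'I_d -> nat) (k : 'I_d) (i j : midx n) :
  i k = j k -> long_index k i = long_index k j -> i = j.
Proof.
move=> ijk /(congr1 val); rewrite /= /long_nat => ij.
suff ijl l : l \in [seq l <- enum 'I_d | l != k] -> i l = j l.
  apply/ffunP => l; have [->//|lk] := eqVneq l k.
  by apply: ijl; rewrite mem_filter lk mem_enum.
move: l; suff: forall s a b,
    foldl (fun a l => a * n l + i l)%N a s =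
    foldl (fun a l => a * n l + j l)%N b s ->
    a = b /\ forall l, l \in s -> i l = j l by move=> /(_ _ _ _ ij)[].
elim=> [|l s IHs] a b //= /IHs[ab ijs].
have nl_gt0 : (0 < n l)%N by apply: leq_ltn_trans (ltn_ord (i l)).
split.
  move/(congr1 (divn^~ (n l))): ab.
  by rewrite !divnMDl// !divn_small ?ltn_ord// !addn0.
move=> x; rewrite inE => /predU1P[->|/ijs//].
move/(congr1 (modn^~ (n l))): ab; rewrite !modnMDl !modn_small ?ltn_ord//.
exact: val_inj.
Qed.

Section Tensors.
Variables (F : numFieldType) (H : lmodType F) (d : nat).
Implicit Types (n m : 'I_d -> nat) (k : 'I_d).

(* Exactly one multi-index i meets the condition; see unfoldE. *)
Definition unfold n k (A : tensor H n) :
    'M[H]_(n k, \prod_(l | l != k) n l) :=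
  \matrix_(a, b)
    oapp A 0 [pick i : midx n | (i k == a) && (long_index k i == b)].

Lemma unfoldE n k (A : tensor H n) (i : midx n) :
  unfold k A (i k) (long_index k i) = A i.
Proof.
rewrite mxE; case: pickP => [j /andP[/eqP jk /eqP jl]|/(_ i)]; last first.
  by rewrite !eqxx.
by rewrite (long_index_inj jk jl).
Qed.

Definition rankT n (A : tensor H n) : d.-tuple nat :=
  [tuple row_rank (unfold k A) | k < d].

(* The subtensor has size #|I_1| x ... x #|I_d|; enum_val lists each index set
   in increasing order. *)
Definition subtensor n (A : tensor H n) (I : forall l, {set 'I_(n l)}) :
    tensor H (fun l => #|I l|) :=
  [ffun i : midx _ => A [ffun l : 'I_d => enum_val (i l)]].

(* The index sets with the full range in mode k. *)
Definition colon n k (I : forall l, {set 'I_(n l)}) :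
    forall l, {set 'I_(n l)} :=
  dfwith I [set: 'I_(n k)].

Lemma card_colon n k (I : forall l, {set 'I_(n l)}) : #|colon k I k| = n k.
Proof. by rewrite /colon dfwith_in cardsT card_ord. Qed.

Lemma prod_card_colon n k (I : forall l, {set 'I_(n l)}) :
  (\prod_(l | l != k) #|colon k I l| = \prod_(l | l != k) #|I l|)%N.
Proof.
by apply: eq_bigr => l lk; rewrite /colon dfwith_out // eq_sym.
Qed.

Definition rows n k (A : tensor H n) (I : forall l, {set 'I_(n l)}) :
    'M[H]_(\prod_(l | l != k) #|I l|, n k) :=
  castmx (prod_card_colon k I, card_colon k I)
         (unfold k (subtensor A (colon k I)))^T.

Section ModeProduct.
Variables (n m : 'I_d -> nat) (k : 'I_d) (eq_mn : forall l, l != k -> m l = n l).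

Lemma eq_prod_dims :
  (\prod_(l | l != k) m l = \prod_(l | l != k) n l)%N.
Proof. exact: eq_bigr. Qed.

(* The tensor C of size m with unfold k C = lmulmx B (unfold k A). *)
Definition mode_prod (A : tensor H n) (B : 'M[F]_(m k, n k)) : tensor H m :=
  [ffun i : midx m => lmulmx B (unfold k A) (i k)
               (cast_ord eq_prod_dims (long_index k i))].

End ModeProduct.

Section TuckerProduct.
Variables (n m : 'I_d -> nat).

(* Sizes once the modes below t have been multiplied. *)
Definition mixed_dims (t : nat) : 'I_d -> nat :=
  fun l => if (l < t)%N then m l else n l.

Lemma mixed_dims_new t (td : (t < d)%N) :
  m (Ordinal td) = mixed_dims t.+1 (Ordinal td).
Proof. by rewrite /mixed_dims /= ltnSn. Qed.

Lemma mixed_dims_old t (td : (t < d)%N) :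
  n (Ordinal td) = mixed_dims t (Ordinal td).
Proof. by rewrite /mixed_dims /= ltnn. Qed.

Lemma mixed_dims_other t (td : (t < d)%N) l :
  l != Ordinal td -> mixed_dims t.+1 l = mixed_dims t l.
Proof.
by rewrite -val_eqE /mixed_dims ltnS (leq_eqVlt l) => /negbTE /= ->.
Qed.

Lemma mixed_dims_all l : mixed_dims d l = m l.
Proof. by rewrite /mixed_dims ltn_ord. Qed.

Variables (A : tensor H n) (B : forall l, 'M[F]_(m l, n l)).

(* A x_1 B_1 x_2 ... x_t B_t *)
Fixpoint tucker_upto (t : nat) : (t <= d)%N -> tensor H (mixed_dims t) :=
  match t with
  | 0 => fun=> A
  | t'.+1 => fun td =>
      mode_prod (mixed_dims_other (td := td)) (tucker_upto (ltnW td))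
        (castmx (mixed_dims_new td, mixed_dims_old td) (B (Ordinal td)))
  end.

Definition tucker : tensor H m :=
  [ffun i : midx m => tucker_upto (leqnn d)
               [ffun l : 'I_d => cast_ord (esym (mixed_dims_all l)) (i l)]].

End TuckerProduct.

End Tensors.

Section TuckerCross.
Variables (R : realType) (f : scalar_kind).
Local Notation F := (scalar_field R f).
Variables (H : completeNormedModType F) (ip : H -> H -> F).

Definition cross_factor d (n : 'I_d -> nat) (A : tensor H n)
    (I : forall l, {set 'I_(n l)}) (k : 'I_d) : 'M[F]_(n k, #|I k|) :=
  (colwise (pinv ip (unfold k (subtensor A I))^T) (rows k A I))^T.

Definition crossT d (n : 'I_d -> nat) (A : tensor H n)
    (I : forall l, {set 'I_(n l)}) : tensor H n :=
  tucker (subtensor A I) (cross_factor A I).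

End TuckerCross.

(* Main.v *)
Require Import Defs.
From HB Require Import structures.
From mathcomp Require Import all_boot all_order all_algebra fingroup perm.
From mathcomp Require Import sesquilinear spectral.
From mathcomp Require Import complex boolp reals topology normedtype.

(* Write M_k for the transposed mode-k unfolding of G, and P_k for the matrix
   M_k^+ R_k. Since M_k M_k^+ M_k = M_k, and M_k is R_k(:, I_k), contracting G
   with the columns of P_k that are indexed by I_k leaves G unchanged. Hence B
   restricts to G, the row matrix rows_k(B) is M_k P_k, and M_k P_k = R_k as soon
   as the columns of R_k are combinations of those of M_k, which is an equality
   of ranks. If moreover R_k and the mode-k unfolding of A have the same rank,
   then the slices of A satisfy the same linear relations as the columns of R_k.
   The relation R_k = R_k(:, I_k) P_k then passes to A; applied in all the modes,
   it expresses A through G as the Tucker product B. *)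

Set Implicit Arguments.
Unset Strict Implicit.
Unset Printing Implicit Defensive.

Import Order.TTheory GRing.Theory Num.Theory.

Local Open Scope ring_scope.

(** * Column rank *)

Section ColumnRank.
Variables (F : numFieldType) (H : lmodType F).

Lemma rmulmxA m n p q (A : 'M[H]_(m, n)) (B : 'M[F]_(n, p)) (C : 'M_(p, q)) :
  rmulmx (rmulmx A B) C = rmulmx A (B *m C).
Proof.
apply/matrixP => i j; rewrite !mxE.
under eq_bigr do rewrite mxE scaler_sumr.
rewrite exchange_big; apply: eq_bigr => k _ /=.
by rewrite mxE scaler_suml; apply: eq_bigr => l _; rewrite scalerA mulrC.
Qed.

Lemma rmulmx1 m n (A : 'M[H]_(m, n)) : rmulmx A 1%:M = A.
Proof.
apply/matrixP => i j; rewrite !mxE (bigD1 j)//= mxE eqxx scale1r big1 ?addr0//.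
by move=> k /negbTE kj; rewrite mxE kj scale0r.
Qed.

Lemma rmulmxBr m n p (A : 'M[H]_(m, n)) (B C : 'M[F]_(n, p)) :
  rmulmx A (B - C) = rmulmx A B - rmulmx A C.
Proof.
apply/matrixP => i j; rewrite !mxE -sumrB; apply: eq_bigr => k _.
by rewrite !mxE scalerBl.
Qed.

Lemma rmulmx0 m n p (A : 'M[H]_(m, n)) : rmulmx A 0 = 0 :> 'M_(m, p).
Proof.
by apply/matrixP => i j; rewrite !mxE big1// => k _; rewrite mxE scale0r.
Qed.

Lemma rmul0mx m n p (B : 'M[F]_(n, p)) : rmulmx 0 B = 0 :> 'M[H]_(m, p).
Proof.
by apply/matrixP => i j; rewrite !mxE big1// => k _; rewrite mxE scaler0.
Qed.

Lemma col_rmulmx m n p (A : 'M[H]_(m, n)) (X : 'M[F]_(n, p)) j :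
  col j (rmulmx A X) = rmulmx A (col j X).
Proof.
by apply/matrixP => a b; rewrite !mxE; apply: eq_bigr => k _; rewrite mxE.
Qed.

Lemma rmulmx_eq0_col m n p (A : 'M[H]_(m, n)) (X : 'M[F]_(n, p)) :
  (forall j, rmulmx A (col j X) = 0) -> rmulmx A X = 0.
Proof.
move=> AX; apply/matrixP => i j.
have := congr1 (fun Y : 'M_(_, _) => Y i 0) (AX j).
by rewrite -col_rmulmx mxE => ->; rewrite !mxE.
Qed.

(** Quantifying over coefficient matrices of every width lets whole matrix identities be cancelled
    on the left, as in [col_free_inj]. *)
Definition col_free m n (A : 'M[H]_(m, n)) :=
  forall p (X : 'M[F]_(n, p)), rmulmx A X = 0 -> X = 0.

Lemma col_free_inj m n p (A : 'M[H]_(m, n)) (X Y : 'M[F]_(n, p)) :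
  col_free A -> rmulmx A X = rmulmx A Y -> X = Y.
Proof.
by move=> Afree AXY; apply/subr0_eq/Afree; rewrite rmulmxBr AXY subrr.
Qed.

Lemma free_colsP m n (A : 'M[H]_(m, n)) (J : {set 'I_n}) :
  free_cols A J -> col_free (colsub (enum_val : 'I_#|J| -> 'I_n) A).
Proof.
move=> AJ p X AX0; apply/matrixP => a b; rewrite mxE.
pose c j := oapp (fun k => X k b) 0 [pick k : 'I_#|J| | enum_val k == j].
have cE (k : 'I_#|J|) : c (enum_val k) = X k b.
  rewrite /c; case: pickP => [l /eqP/enum_val_inj->//|/(_ k)].
  by rewrite eqxx.
rewrite -cE; apply: AJ (enum_valP a) => i.
have := congr1 (fun Y : 'M_(_, _) => Y i b) AX0; rewrite !mxE.
by apply: etrans; rewrite big_enum_val; apply: eq_bigr => k _; rewrite mxE cE.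
Qed.

Lemma free_cols0 m n (A : 'M[H]_(m, n)) : free_cols A set0.
Proof. by move=> c _ j; rewrite inE. Qed.

(** Full-rank factorization: [C] is a largest free set of columns of [A], [W] holds the coordinates
    in this basis, and [S] selects the basis columns. Through it, rank comparisons reduce to scalar
    matrices. *)
Lemma rank_factor m n (A : 'M[H]_(m, n)) :
  exists r (C : 'M[H]_(m, r)) (W : 'M[F]_(r, n)) (S : 'M[F]_(n, r)),
    [/\ col_rank A = r, col_free C, A = rmulmx C W & W *m S = 1%:M].
Proof.
have [J /asboolP Jfree rankJ] :
    {J : {set 'I_n} | `[< free_cols A J >] & col_rank A = #|J|}.
  apply: eq_bigmax_cond; apply/card_gt0P; exists set0.
  by apply/asboolP/free_cols0.
have Jmax j :
    exists w : 'I_n -> F, forall i, A i j = \sum_(k in J) w k *: A i k.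
  have [jJ|jJ] := boolP (j \in J).
    exists (fun k => (k == j)%:R) => i; rewrite (bigD1 j)//= eqxx scale1r.
    by rewrite big1 ?addr0// => k /andP[_ /negbTE->]; rewrite scale0r.
  (* Maximality of [J] yields a nontrivial relation on [j |: J]. Since [J] is free, its coefficient
     at [j] is nonzero, so it can be solved for column [j]. *)
  have : ~ free_cols A (j |: J).
    move=> /asboolP jJfree; have : (#|j |: J| <= col_rank A)%N.
      exact: (@leq_bigmax_cond _ (fun J => `[< free_cols A J >])
        (fun J => #|J|)).
    by rewrite rankJ cardsU1 jJ add1n ltnn.
  move=> /existsNP[c] /not_implyP[c0] /existsNP[l] /not_implyP[lJ cl].
  have {}c0 i : c j *: A i j + \sum_(k in J) c k *: A i k = 0.
    by have := c0 i; rewrite big_setU1.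
  have cj : c j != 0.
    apply/eqP => cj; apply/cl; move: lJ; rewrite in_setU1 => /predU1P[->//|].
    by apply: Jfree => i; rewrite -[RHS](c0 i) cj scale0r add0r.
  exists (fun k => - (c j)^-1 * c k) => i.
  under eq_bigr do rewrite -scalerA.
  rewrite -scaler_sumr scaleNr; apply/eqP; rewrite -addr_eq0; apply/eqP.
  by rewrite -[A i j](scalerK cj) -scalerDr c0 scaler0.
have {Jmax} [w wE] := choice Jmax.
exists #|J|, (colsub enum_val A), (\matrix_(k, j) w j (enum_val k)).
exists (colsub enum_val 1%:M).
have AE : A = rmulmx (colsub (enum_val : 'I_#|J| -> _) A)
                (\matrix_(k, j) w j (enum_val k)).
  apply/matrixP => i j; rewrite !mxE wE.
  under [RHS]eq_bigr do rewrite !mxE.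
  exact: big_enum_val.
split => //; first exact: free_colsP.
apply: (col_free_inj (free_colsP Jfree)).
rewrite -rmulmxA -AE rmulmx1; apply/matrixP => i j; rewrite !mxE.
rewrite (bigD1 (enum_val j))//= !mxE eqxx scale1r big1 ?addr0// => k /negbTE kj.
by rewrite !mxE kj scale0r.
Qed.

(** If [r < q], then [W] has a nonzero kernel, spanned by the columns of [cokermx W]. By hypothesis
    [C] kills these columns, against its freeness. *)
Lemma col_free_mul_le m p q r (C : 'M[H]_(m, q)) (D : 'M[H]_(p, r))
    (W : 'M[F]_(r, q)) : col_free C ->
  (forall e : 'cV_q, rmulmx D (W *m e) = 0 -> rmulmx C e = 0) -> (q <= r)%N.
Proof.
move=> Cfree DC; rewrite leqNgt; apply/negP => rq.
have : cokermx W != 0.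
  by rewrite -mxrank_eq0 mxrank_coker subn_eq0 -ltnNge
    (leq_ltn_trans (rank_leq_row _)).
case/matrix0Pn => i [j].
have -> : cokermx W i j = col j (cokermx W) i 0 by rewrite [RHS]mxE.
suff -> : col j (cokermx W) = 0 by rewrite mxE eqxx.
by apply/Cfree/DC; rewrite colE mulmxA mulmx_coker mul0mx rmulmx0.
Qed.

(** By rank-nullity, an inclusion of kernels bounds the rank. Comparing kernels allows [X] and [M]
    to have different numbers of rows, as an unfolding and a row matrix do. *)
Lemma col_rank_le m n m' p (X : 'M[H]_(m, n)) (M : 'M[H]_(m', p))
    (W : 'M[F]_(p, n)) :
  (forall e : 'cV_n, rmulmx M (W *m e) = 0 -> rmulmx X e = 0) ->
  (col_rank X <= col_rank M)%N.
Proof.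
move=> MX.
have [q [C [V [S [-> Cfree XE VS]]]]] := rank_factor X.
have [q' [D [U [T [-> Dfree ME UT]]]]] := rank_factor M.
apply: (@col_free_mul_le _ _ _ _ C D (U *m W *m S)) => // e De.
have := MX (S *m e); rewrite ME XE !rmulmxA !mulmxA VS mul1mx; apply.
by rewrite -De ?mulmxA.
Qed.

Lemma col_rank_rmulmx m n p (A : 'M[H]_(m, n)) (X : 'M[F]_(n, p)) :
  (col_rank (rmulmx A X) <= col_rank A)%N.
Proof. by apply: (col_rank_le (W := X)) => e; rewrite rmulmxA. Qed.

(** Both [C] and the free factor [D] from [rank_factor] are column combinations of [A], so
    [col_free_mul_le] applies in both directions. *)
Lemma col_rank_eq m n r (A : 'M[H]_(m, n)) (C : 'M[H]_(m, r))
    (W : 'M[F]_(r, n)) (S : 'M[F]_(n, r)) :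
  col_free C -> A = rmulmx C W -> W *m S = 1%:M -> col_rank A = r.
Proof.
move=> Cfree AE WS.
have [q [D [V [T [-> Dfree AE' VT]]]]] := rank_factor A.
have CE : C = rmulmx A S by rewrite AE rmulmxA WS rmulmx1.
have DE : D = rmulmx A T by rewrite AE' rmulmxA VT rmulmx1.
apply/eqP; rewrite eqn_leq; apply/andP; split.
  apply: (@col_free_mul_le _ _ _ _ D C (W *m T)) => // e.
  by rewrite -!rmulmxA -AE -DE.
apply: (@col_free_mul_le _ _ _ _ C D (V *m S)) => // e.
by rewrite -!rmulmxA -AE' -CE.
Qed.

(** In the factorizations [X = C V] and [M = D U], the factor [V] vanishes on the kernel of [U],
    hence [V = V T U]. With equal ranks [V T] is square and invertible, so [V] and [U] have the same
    kernel. *)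
Lemma rel_eq_of_rank m m' n (M : 'M[H]_(m, n)) (X : 'M[H]_(m', n)) :
  (forall e : 'cV[F]_n, rmulmx M e = 0 -> rmulmx X e = 0) ->
  col_rank M = col_rank X ->
  forall p (Y : 'M[F]_(n, p)), rmulmx X Y = 0 -> rmulmx M Y = 0.
Proof.
move=> MX.
have [r [C [V [S [-> Cfree XE VS]]]]] := rank_factor X.
have [r' [D [U [T [-> Dfree ME UT]]]]] := rank_factor M.
move=> rr'; case: r / rr' in C V S Cfree XE VS *.
have VE : V = V *m T *m U.
  apply: (col_free_inj Cfree); rewrite -XE -!rmulmxA -XE rmulmxA.
  apply/subr0_eq; rewrite -{1}[X]rmulmx1 -rmulmxBr.
  (* The columns of [1 - T U] are relations of [M], because [U T = 1]. *)
  apply: rmulmx_eq0_col => j; apply: MX; rewrite -col_rmulmx.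
  have -> : rmulmx M (1%:M - T *m U) = 0; last by rewrite !raddf0.
  by rewrite ME rmulmxA mulmxBr mulmxA UT mul1mx mulmx1 subrr rmulmx0.
have VTu : V *m T \in unitmx.
  suff : V *m T *m (U *m S) = 1%:M by case/mulmx1_unit.
  by rewrite mulmxA -VE VS.
move=> p Y; rewrite XE rmulmxA => /Cfree VY.
rewrite ME rmulmxA -[U]mul1mx -(mulVmx VTu) -!mulmxA (mulmxA V) (mulmxA _ U).
by rewrite -VE VY mulmx0 rmulmx0.
Qed.

(** From [R = C V] and [R E = D U] with [U T = 1] follows [D = C V E T]. Equal ranks make [V E T]
    square, and freeness of [D] makes it invertible, so [C], and with it [R], is recovered from
    [R E]. *)
Lemma span_eq_of_rank m n p (R : 'M[H]_(m, n)) (E : 'M[F]_(n, p)) :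
  col_rank (rmulmx R E) = col_rank R -> exists Y, R = rmulmx (rmulmx R E) Y.
Proof.
have [r [C [V [S [-> Cfree RE VS]]]]] := rank_factor R.
have [r' [D [U [T [-> Dfree ME UT]]]]] := rank_factor (rmulmx R E).
move=> rr'; case: r / rr' in C V S Cfree RE VS *.
have DE : D = rmulmx C (V *m E *m T).
  by rewrite -[D]rmulmx1 -UT -rmulmxA -ME {1}RE !rmulmxA !mulmxA.
have VETu : V *m E *m T \in unitmx.
  (* [kermx] is a left kernel, while freeness of [D] concerns multiplication on the right; hence the
     transposes. *)
  rewrite -unitmx_tr -row_free_unit -kermx_eq0; apply/eqP.
  apply: trmx_inj; rewrite trmx0; apply: Dfree.
  rewrite DE rmulmxA; have -> : V *m E *m T *m (kermx (V *m E *m T)^T)^T = 0.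
    by apply: trmx_inj; rewrite trmx_mul trmxK mulmx_ker trmx0.
  exact: rmulmx0.
exists (T *m invmx (V *m E *m T) *m V).
by rewrite ME !rmulmxA !mulmxA UT mul1mx DE rmulmxA mulmxA mulmxV// mul1mx.
Qed.

End ColumnRank.

(** * Hermitian matrices over the scalar field *)

Section ScalarField.
Variables (R : realType) (f : scalar_kind).
Local Notation F := (scalar_field R f).

Fact conj_scalar_is_zmod_morphism : zmod_morphism (@conj_scalar R f).
Proof. by case: f => // x y; exact: rmorphB. Qed.

Fact conj_scalar_is_monoid_morphism : monoid_morphism (@conj_scalar R f).
Proof. by case: f => //; split=> [|x y]; [exact: rmorph1|exact: rmorphM]. Qed.

HB.instance Definition _ :=
  GRing.isZmodMorphism.Build F F (@conj_scalar R f)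
    conj_scalar_is_zmod_morphism.
HB.instance Definition _ :=
  GRing.isMonoidMorphism.Build F F (@conj_scalar R f)
    conj_scalar_is_monoid_morphism.

Fact of_real_is_zmod_morphism : zmod_morphism (@of_real R f).
Proof. by case: f => // x y; exact: rmorphB. Qed.

Fact of_real_is_monoid_morphism : monoid_morphism (@of_real R f).
Proof. by case: f => //; split=> [|x y]; [exact: rmorph1|exact: rmorphM]. Qed.

HB.instance Definition _ :=
  GRing.isZmodMorphism.Build R F (@of_real R f) of_real_is_zmod_morphism.
HB.instance Definition _ :=
  GRing.isMonoidMorphism.Build R F (@of_real R f) of_real_is_monoid_morphism.

(** Both kinds of scalars embed in [R[i]], where the spectral theorem is applied. *)
Definition to_complex : F -> R[i] :=
  match f with RealScalars => real_complex R | ComplexScalars => id end.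

Fact to_complex_is_zmod_morphism : zmod_morphism to_complex.
Proof. by rewrite /to_complex; case: f => // x y; exact: rmorphB. Qed.

Fact to_complex_is_monoid_morphism : monoid_morphism to_complex.
Proof.
rewrite /to_complex; case: f => //.
by split=> [|x y]; [exact: rmorph1|exact: rmorphM].
Qed.

HB.instance Definition _ :=
  GRing.isZmodMorphism.Build F R[i] to_complex to_complex_is_zmod_morphism.
HB.instance Definition _ :=
  GRing.isMonoidMorphism.Build F R[i] to_complex to_complex_is_monoid_morphism.

Lemma conj_scalarK : involutive (@conj_scalar R f).
Proof. by case: f => //; exact: conjcK. Qed.

Lemma conj_of_real (x : R) : conj_scalar (of_real f x) = of_real f x.
Proof. by case: f => //; exact: conjc_real. Qed.

Lemma of_real_ge0 (x : R) : (0 <= of_real f x) = (0 <= x).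
Proof. by case: f => //; exact: ler0c. Qed.

Lemma ge0_of_real (x : F) : 0 <= x -> exists2 y : R, 0 <= y & x = of_real f y.
Proof.
case: f x => [x x0|x x0]; first by exists x.
exists (complex.Re x); last exact/esym/RRe_real/ger0_real.
by rewrite -ler0c; rewrite RRe_real// ger0_real.
Qed.

Lemma mul_conj_ge0 (x : F) : 0 <= conj_scalar x * x.
Proof.
case: f x => x; first by rewrite /= -expr2 sqr_ge0.
by rewrite mulrC; exact: mulcJ_ge0.
Qed.

Lemma to_complexJ (x : F) : to_complex (conj_scalar x) = (to_complex x)^*.
Proof.
rewrite /to_complex; case: f x => x /=; last by [].
by rewrite -[LHS]conjc_real.
Qed.

Lemma to_complex_real (x : R) : to_complex (of_real f x) = x%:C%C.
Proof. by rewrite /to_complex; case: f. Qed.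

Lemma adj_scalarM m n p (A : 'M[F]_(m, n)) (B : 'M[F]_(n, p)) :
  adj_scalar (A *m B) = adj_scalar B *m adj_scalar A.
Proof. by rewrite /adj_scalar trmx_mul map_mxM. Qed.

Lemma adj_scalarK m n (A : 'M[F]_(m, n)) : adj_scalar (adj_scalar A) = A.
Proof. by apply/matrixP => i j; rewrite !mxE conj_scalarK. Qed.

Lemma adj_scalarB m n (A B : 'M[F]_(m, n)) :
  adj_scalar (A - B) = adj_scalar A - adj_scalar B.
Proof. by rewrite /adj_scalar linearB map_mxB. Qed.

Lemma adj_scalarZ m n (x : R) (A : 'M[F]_(m, n)) :
  adj_scalar (of_real f x *: A) = of_real f x *: adj_scalar A.
Proof. by rewrite /adj_scalar linearZ map_mxZ /= conj_of_real. Qed.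

Lemma adj_real_diag n (s : 'rV[R]_n) :
  adj_scalar (real_diag f s) = real_diag f s.
Proof.
by rewrite /adj_scalar tr_diag_mx map_diag_mx; congr diag_mx;
  apply/matrixP => i j; rewrite !mxE /= conj_of_real.
Qed.

Lemma mul_real_diag n (s t : 'rV[R]_n) :
  real_diag f s *m real_diag f t = real_diag f (\row_j (s 0 j * t 0 j)).
Proof.
rewrite mulmx_diag; congr diag_mx.
by apply/matrixP => i j; rewrite !mxE rmorphM.
Qed.

Lemma mul_real_diagV n (s t : 'rV[R]_n) :
  (forall i, s 0 i * t 0 i = 1) -> real_diag f s *m real_diag f t = 1%:M.
Proof.
move=> st; rewrite mul_real_diag; apply/matrixP => i j.
by rewrite !mxE st rmorph1.
Qed.

Lemma adj_mul_self_eq0 n (v : 'cV[F]_n) : adj_scalar v *m v = 0 -> v = 0.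
Proof.
move=> /(congr1 (fun Y : 'M_(_, _) => Y 0 0)); rewrite !mxE => v0.
have {v0} : \sum_i conj_scalar (v i 0) * v i 0 = 0.
  by apply: etrans v0; apply: eq_bigr => i _; rewrite !mxE.
move=> /psumr_eq0P v0; apply/matrixP => i j; rewrite ord1 mxE.
have /eqP := v0 (fun i _ => mul_conj_ge0 _) i isT.
by rewrite mulf_eq0 fmorph_eq0 orbb => /eqP.
Qed.

Lemma normalize n (v : 'cV[F]_n) : v != 0 ->
  exists2 x : R, x != 0 &
    adj_scalar (of_real f x *: v) *m (of_real f x *: v) = 1%:M.
Proof.
move=> v0; have [|y y0 yE] := @ge0_of_real ((adj_scalar v *m v) 0 0).
  by rewrite mxE sumr_ge0// => i _; rewrite !mxE mul_conj_ge0.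
have yE' : adj_scalar v *m v = (of_real f y)%:M by rewrite [LHS]mx11_scalar yE.
have {}y0 : 0 < y.
  rewrite lt_def y0 andbT; apply: contraNneq v0 => y00; apply/eqP.
  by apply: adj_mul_self_eq0; rewrite yE' y00 rmorph0 raddf0.
exists (Num.sqrt y)^-1; first by rewrite invr_eq0 sqrtr_eq0 -ltNge.
rewrite adj_scalarZ -scalemxAl -scalemxAr yE' scalerA -rmorphM /=.
rewrite scale_scalar_mx -rmorphM /= -invfM -expr2 sqr_sqrtr ?ltW//.
by rewrite mulVf ?gt_eqF// rmorph1.
Qed.

(* Over the reals the eigenvector is found by complexification: the eigenvalues
   of the hermitian matrix are real, and having a given real eigenvalue does not
   depend on the field. *)
Lemma hermitian_eigenvector n (K : 'M[F]_n) : adj_scalar K = K -> K != 0 ->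
  exists2 x : R, x != 0 &
    exists2 v : 'cV[F]_n, v != 0 & K *m v = of_real f x *: v.
Proof.
move=> Kherm K0; pose KC := map_mx to_complex K.
have KCherm : KC \is hermsymmx.
  apply/is_hermitianmxP; rewrite expr0 scale1r.
  by apply/matrixP => i j; rewrite !mxE -{1}Kherm !mxE to_complexJ.
have /hermitian_normalmx/orthomx_spectralP KCE := KCherm.
have := hermitian_spectral_diag_real KCherm.
move: (spectral_diag KC) (spectralmx KC) (spectral_unit KC) KCE.
move=> d P Pu KCE dreal.
have [i di] : exists i, d 0 i != 0.
  apply/existsP; rewrite -negb_forall; apply: contra K0 => /forallP d0.
  rewrite -(map_mx_eq0 to_complex) -/KC KCE.
  suff -> : d = 0 by rewrite raddf0 mulmx0 mul0mx.
  by apply/matrixP => i j; rewrite ord1 (eqP (d0 j)) mxE.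
have /complex_realP[x xE] : d 0 i \is Num.real by exact: (mxOverP dreal).
have x0 : x != 0.
  by apply: contraNneq di => x0; rewrite xE x0.
have : eigenvalue KC (to_complex (of_real f x)).
  apply/eigenvalueP; exists (row i P).
    rewrite to_complex_real -xE KCE -row_mul !mulmxA mulmxV// mul1mx.
    by rewrite mul_diag_mx; apply/matrixP => a b; rewrite !mxE.
  apply: contraTneq (Pu) => Pi0; rewrite -row_free_unit.
  by apply/row_freePn; exists i; rewrite Pi0 sub0mx.
(* [eigenvalue] refers to row vectors; as [K] is hermitian, the adjoint of a row eigenvector is a
   column eigenvector for the same real eigenvalue. *)
rewrite /KC eigenvalue_map => /eigenvalueP[v vK v0].
exists x => //; exists (adj_scalar v).
  by rewrite /adj_scalar map_mx_eq0 trmx_eq0.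
by rewrite -{1}Kherm -adj_scalarM vK adj_scalarZ.
Qed.

(* Induction on the rank: subtracting [x v v^*] for a unit eigenvector [v] adds
   [v] to the kernel. *)
Lemma hermitian_spectral n (K : 'M[F]_n) : adj_scalar K = K ->
  exists r (V : 'M[F]_(n, r)) (d : 'rV[R]_r),
    [/\ adj_scalar V *m V = 1%:M, forall i, d 0 i != 0
      & K = V *m real_diag f d *m adj_scalar V].
Proof.
have [k] := ubnP (\rank K); elim: k K => // k IHk K rankK Kherm.
have [K0|K0] := eqVneq K 0.
  exists 0%N, 0, 0; split => [|[]//|]; last by rewrite mul0mx mul0mx.
  by apply/matrixP => -[].
have [x x0 [v0 v00 Kv0]] := hermitian_eigenvector Kherm K0.
have [y y0 vv] := normalize v00; set v := of_real f y *: v0 in vv.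
have Kv : K *m v = of_real f x *: v by rewrite -scalemxAr Kv0 !scalerA mulrC.
have vK : adj_scalar v *m K = of_real f x *: adj_scalar v.
  by rewrite -{1}Kherm -adj_scalarM Kv adj_scalarZ.
pose K' := K - of_real f x *: (v *m adj_scalar v).
have K'herm : adj_scalar K' = K'.
  by rewrite adj_scalarB Kherm adj_scalarZ adj_scalarM adj_scalarK.
have K'v : K' *m v = 0.
  by rewrite mulmxBl Kv -scalemxAl -mulmxA vv mulmx1 subrr.
have vK' : adj_scalar v *m K' = 0.
  by rewrite mulmxBr vK -scalemxAr mulmxA vv mul1mx subrr.
have [||r [V [d [VV d0 K'E]]]] := IHk K' => //.
  rewrite -ltnS; apply: leq_ltn_trans rankK.
  have : (kermx K < kermx K')%MS.
    apply/andP; split.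
      (* The old kernel is kept: a row killing [K] also kills [v], a multiple of [K v]. *)
      apply/sub_kermxP; rewrite mulmxBr mulmx_ker sub0r -scalemxAr.
      rewrite -[v](scalerK (a := of_real f x)) ?fmorph_eq0//.
      rewrite -Kv mulmxA -scalemxAr mulmxA mulmx_ker mul0mx.
      by rewrite scaler0 mul0mx scaler0 oppr0.
    apply/negP => K'K.
    have : (adj_scalar v <= kermx K)%MS.
      by apply: submx_trans K'K; apply/sub_kermxP.
    move=> /sub_kermxP; rewrite vK => /eqP.
    rewrite scaler_eq0 fmorph_eq0 (negbTE x0) /= => /eqP v'0.
    by have /eqP := vv; rewrite v'0 mul0mx eq_sym oner_eq0.
  move=> /rank_ltmx; rewrite !mxrank_ker.
  by rewrite ltn_sub2lE // rank_leq_row.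
(* [K' v = 0] and the diagonal factor of [K'] is invertible, so [v] is orthogonal to the columns of
   [V]. *)
have Vv : adj_scalar V *m v = 0.
  have := congr1 (mulmx (adj_scalar V)) K'v.
  rewrite K'E !mulmxA VV mul1mx mulmx0.
  move=> /(congr1 (mulmx (real_diag f (\row_j (d 0 j)^-1)))).
  rewrite !mulmxA mul_real_diagV ?mul1mx ?mulmx0// => i.
  by rewrite mxE mulVf.
have vV : adj_scalar v *m V = 0.
  by rewrite -[V]adj_scalarK -adj_scalarM Vv /adj_scalar trmx0 map_mx0.
have adj_row p (X : 'M[F]_(n, p)) :
    adj_scalar (row_mx v X) = col_mx (adj_scalar v) (adj_scalar X).
  by rewrite /adj_scalar tr_row_mx map_col_mx.
exists (1 + r)%N, (row_mx v V), (row_mx x%:M d); split.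
- by rewrite adj_row mul_col_row vv VV vV Vv -scalar_mx_block.
- move=> i; rewrite mxE; case: split => j; last exact: d0.
  by rewrite ord1 mxE eqxx.
- rewrite adj_row /real_diag map_row_mx diag_mx_row mul_row_block !mulmx0.
  rewrite addr0 add0r mul_row_col -/(real_diag _ _) -K'E.
  suff -> : v *m diag_mx (map_mx (of_real f) x%:M) *m adj_scalar v =
            of_real f x *: (v *m adj_scalar v) by rewrite addrC subrK.
  rewrite scalemxAl -mul_mx_scalar; congr (_ *m _ *m _).
  by apply/matrixP => i j; rewrite !ord1 !mxE eqxx.
Qed.

End ScalarField.

(** * Singular value decomposition and pseudoinverse *)

Section SVD.
Variables (R : realType) (f : scalar_kind).
Local Notation F := (scalar_field R f).

Lemma sort_perm r (d : 'rV[R]_r) : exists s : 'S_r,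
  forall i j : 'I_r, (i <= j)%N -> d 0 (s j) <= d 0 (s i).
Proof.
pose le (i j : 'I_r) := d 0 j <= d 0 i.
have le_total : total le by move=> i j; exact: le_total.
have le_trans : transitive le by move=> j i k ij jk; exact: le_trans jk ij.
have : perm_eq (sort le (enum 'I_r)) (ord_tuple r) 
  by rewrite perm_sort val_ord_tuple.
move=> /tuple_permP[s sE]; exists s => i j ij.
have := sort_sorted le_total (enum 'I_r).
rewrite sE => /(sorted_leq_nth le_trans (fun i => lexx (d 0 i)) i).
move=> /(_ i j); rewrite !inE size_tuple !ltn_ord => /(_ isT isT ij).
by rewrite -!tnth_nth !tnth_mktuple !tnth_ord_tuple.
Qed.

Lemma hermitian_spectral_sorted n (K : 'M[F]_n) : adj_scalar K = K ->
  exists r (V : 'M[F]_(n, r)) (d : 'rV[R]_r),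
    [/\ adj_scalar V *m V = 1%:M, forall i, d 0 i != 0,
        forall i j : 'I_r, (i <= j)%N -> d 0 j <= d 0 i
      & K = V *m real_diag f d *m adj_scalar V].
Proof.
move=> /hermitian_spectral[r [V [d [VV d0 KE]]]].
have [s sd] := sort_perm d.
pose P : 'M[F]_r := perm_mx s^-1.
have adjP : adj_scalar P = P^T by rewrite /adj_scalar tr_perm_mx map_perm_mx.
have PP : P *m P^T = 1%:M by rewrite tr_perm_mx -perm_mxM mulgV perm_mx1.
have PP' : P^T *m P = 1%:M by rewrite tr_perm_mx -perm_mxM mulVg perm_mx1.
exists r, (V *m P), (\row_j d 0 (s j)); split.
- by rewrite adj_scalarM adjP mulmxA -(mulmxA P^T) VV mulmx1.
- by move=> i; rewrite mxE.
- by move=> i j ij; rewrite !mxE sd.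
- have -> : real_diag f (\row_j d 0 (s j)) = P^T *m real_diag f d *m P.
    rewrite tr_perm_mx invgK -row_permE -col_permE; apply/matrixP => i j.
    by rewrite !mxE (inj_eq perm_inj).
  by rewrite adj_scalarM adjP !mulmxA -!(mulmxA _ P) PP !mulmx1.
Qed.

Variables (H : completeNormedModType F) (ip : {dot H for @conj_scalar R f}).

Lemma ipC x y : ip x y = conj_scalar (ip y x).
Proof. by rewrite hermitian_subproof expr0 mul1r. Qed.

Lemma ip_sumZl (J : finType) (c : J -> F) (x : J -> H) y :
  ip (\sum_j c j *: x j) y = \sum_j c j * ip (x j) y.
Proof.
rewrite linear_sumlz; apply: eq_bigr => j _.
by rewrite linearZl_LR.
Qed.

Lemma ip_ge0 x : 0 <= ip x x.
Proof.
have [->|x0] := eqVneq x 0; last exact/ltW/neq0_dnorm_gt0.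
by rewrite linear0l.
Qed.

Local Notation gram U A := (colwise (adjoint ip U) A).

Lemma gramE m p n (U : 'M[H]_(m, p)) (A : 'M[H]_(m, n)) i j :
  gram U A i j = \sum_k ip (A k j) (U k i).
Proof. by rewrite !mxE; apply: eq_bigr => k _; rewrite !mxE. Qed.

Lemma adj_gram m p n (U : 'M[H]_(m, p)) (A : 'M[H]_(m, n)) :
  adj_scalar (gram U A) = gram A U.
Proof.
apply/matrixP => i j; rewrite gramE mxE [in LHS]mxE gramE rmorph_sum.
by apply: eq_bigr => k _; rewrite /= -ipC.
Qed.

Lemma gram_mulr m p n q (U : 'M[H]_(m, p)) (A : 'M[H]_(m, n))
    (X : 'M[F]_(n, q)) :
  gram U (rmulmx A X) = gram U A *m X.
Proof.
apply/matrixP => i j; rewrite gramE mxE.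
under [RHS]eq_bigr do rewrite gramE mulr_suml.
rewrite exchange_big; apply: eq_bigr => k _ /=.
by rewrite mxE ip_sumZl; apply: eq_bigr => l _; rewrite mulrC.
Qed.

Lemma gram_mull m p n q (U : 'M[H]_(m, p)) (A : 'M[H]_(m, n))
    (X : 'M[F]_(p, q)) :
  gram (rmulmx U X) A = adj_scalar X *m gram U A.
Proof. by rewrite -adj_gram gram_mulr adj_scalarM adj_gram. Qed.

Lemma gram_eq0 m n (A : 'M[H]_(m, n)) : gram A A = 0 -> A = 0.
Proof.
move=> AA; apply/matrixP => i j; rewrite mxE; apply/eqP/negPn/negP => Aij.
have := gramE A A j j; rewrite AA mxE => /esym/psumr_eq0P A0.
have : 0 < ip (A i j) (A i j) by exact: neq0_dnorm_gt0.
by rewrite (A0 (fun k _ => ip_ge0 _)) ?ltxx.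
Qed.

Lemma gram_diag_ge0 m n (A : 'M[H]_(m, n)) i : 0 <= gram A A i i.
Proof. by rewrite gramE sumr_ge0// => k _; exact: ip_ge0. Qed.

Lemma col_free_orthonormal m n (U : 'M[H]_(m, n)) :
  gram U U = 1%:M -> col_free U.
Proof.
move=> UU p X UX0; rewrite -[X]mul1mx -UU -gram_mulr UX0.
apply/matrixP => i j; rewrite gramE mxE big1// => k _.
by rewrite mxE linear0l.
Qed.

(** From the spectral decomposition [V D V^*] of [A^* A], take for [s] the square roots of the
    entries of [D], and [U = A V s^-1]. *)
Lemma svd_exists m n (A : 'M[H]_(m, n)) :
  exists (U : 'M[H]_(m, col_rank A)) (s : 'rV[R]_(col_rank A))
         (V : 'M[F]_(n, col_rank A)), is_svd ip A U s V.
Proof.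
suff [r [U [s [V svd]]]] : exists r (U : 'M[H]_(m, r)) (s : 'rV[R]_r)
    (V : 'M[F]_(n, r)), is_svd ip A U s V.
  (* Any such decomposition has inner dimension [col_rank A]: [U] is free, and the factor [s V^*]
     has the right inverse [V s^-1]. *)
  suff -> : col_rank A = r by exists U, s, V.
  have [UU s0 _ VV AE] := svd.
  have sV : real_diag f s *m real_diag f (\row_j (s 0 j)^-1) = 1%:M.
    by apply: mul_real_diagV => i; rewrite mxE mulfV// gt_eqF.
  apply: (@col_rank_eq _ _ _ _ _ A U (real_diag f s *m adj_scalar V)
           (V *m real_diag f (\row_j (s 0 j)^-1))).
  - exact: col_free_orthonormal.
  - by rewrite AE rmulmxA.
  - by rewrite mulmxA -(mulmxA _ (adj_scalar V)) VV mulmx1.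
have [r [V [d [VV d0 d_sorted AAE]]]] :=
  hermitian_spectral_sorted (adj_gram A A).
have VAAV : gram (rmulmx A V) (rmulmx A V) = real_diag f d.
  by rewrite gram_mulr gram_mull AAE !mulmxA VV mul1mx -mulmxA VV mulmx1.
have d_gt0 i : 0 < d 0 i.
  rewrite lt_def d0 -(of_real_ge0 f).
  by have := gram_diag_ge0 (rmulmx A V) i; rewrite VAAV !mxE eqxx.
have sqrt_neq0 i : Num.sqrt (d 0 i) != 0 by rewrite sqrtr_eq0 -ltNge.
pose s := \row_j Num.sqrt (d 0 j); pose s' := \row_j (s 0 j)^-1.
have s's : real_diag f s' *m real_diag f s = 1%:M.
  by apply: mul_real_diagV => i; rewrite !mxE mulVf.
have ss' : real_diag f s *m real_diag f s' = 1%:M.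
  by apply: mul_real_diagV => i; rewrite !mxE mulfV.
have dE : real_diag f d = real_diag f s *m real_diag f s.
  rewrite mul_real_diag; congr real_diag; apply/rowP => i.
  by rewrite !mxE -expr2 sqr_sqrtr// ltW.
exists r, (rmulmx A (V *m real_diag f s')), s, V; split => //.
- rewrite -rmulmxA gram_mulr gram_mull VAAV adj_real_diag dE.
  by rewrite !mulmxA s's mul1mx ss'.
- by move=> i; rewrite mxE sqrtr_gt0.
- by move=> i j ij; rewrite !mxE ler_wsqrtr ?d_sorted.
- rewrite !rmulmxA !mulmxA -(mulmxA V) s's mulmx1.
  (* The difference [A - A V V^*] vanishes because its Gram matrix does. *)
  apply/subr0_eq; rewrite -{1}[A]rmulmx1 -rmulmxBr.
  apply: gram_eq0; rewrite gram_mulr gram_mull AAE.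
  rewrite -!mulmxA mulmxBr mulmx1 (mulmxA (adj_scalar V)) VV mul1mx subrr.
  by rewrite !mulmx0.
Qed.

(** Since an SVD exists, [xget] returns one and never its default value. The pseudoinverse of a
    nonzero matrix is handled below through this unspecified SVD. *)
Lemma pinv_svd m n (A : 'M[H]_(m, n)) : A != 0 ->
  exists r (U : 'M[H]_(m, r)) (s : 'rV[R]_r) (V : 'M[F]_(n, r)),
    is_svd ip A U s V /\ forall p (B : 'M[H]_(m, p)),
      colwise (pinv ip A) B =
      V *m real_diag f (map_mx GRing.inv s) *m gram U B.
Proof.
move=> /negbTE A0; have [U [s [V svd]]] := svd_exists A.
pose P (usv : 'M[H]_(m, col_rank A) * 'rV[R]_(col_rank A) *
  'M[F]_(n, col_rank A)) := is_svd ip A usv.1.1 usv.1.2 usv.2.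
have svd' := @classical_sets.xgetPex _ (0, 0, 0) P (ex_intro _ (U, s, V) svd).
exists (col_rank A); do 3!eexists; split; first exact: svd'.
move=> p B; apply/matrixP => i j; rewrite /pinv A0 !mxE /=.
by apply: eq_bigr => k _; rewrite !mxE.
Qed.

Lemma pinv_mulr m n p q (A : 'M[H]_(m, n)) (B : 'M[H]_(m, p))
    (X : 'M[F]_(p, q)) :
  colwise (pinv ip A) (rmulmx B X) = colwise (pinv ip A) B *m X.
Proof.
have [A0|] := eqVneq A 0; last first.
  by move=> /pinv_svd[r [U [s [V [_ AE]]]]]; rewrite !AE gram_mulr mulmxA.
rewrite /pinv A0 eqxx; apply/matrixP => i j; rewrite !mxE big1// => k _.
by rewrite !mxE mul0r.
Qed.

(** [A^+ A] collapses to [V V^*], which [A] absorbs on the right because [V^* V = 1]. *)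
Lemma mul_pinv_id m n (A : 'M[H]_(m, n)) :
  rmulmx A (colwise (pinv ip A) A) = A.
Proof.
have [->|] := eqVneq A 0; first exact: rmul0mx.
move=> /pinv_svd[r [U [s [V [[UU s0 _ VV AE] ->]]]]].
have s's : real_diag f (map_mx GRing.inv s) *m real_diag f s = 1%:M.
  by apply: mul_real_diagV => i; rewrite !mxE mulVf// gt_eqF.
rewrite {2 3}AE gram_mulr gram_mulr UU mul1mx.
rewrite -!mulmxA (mulmxA _ (real_diag f s)) s's mul1mx AE !rmulmxA.
congr rmulmx; congr (_ *m _).
by rewrite mulmxA VV mul1mx.
Qed.

End SVD.

(** * Slices and contractions of tensors *)

Section MultiIndex.
Variable d : nat.
Implicit Types (n m : 'I_d -> nat) (k l : 'I_d).

(** As [a] varies, [upd i a] runs through the mode-[k] fibre of [i]; sums over such fibres stand for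
    products with transposed unfoldings. *)
Definition upd n (i : midx n) k (a : 'I_(n k)) : midx n :=
  [ffun l => dfwith (fun l => i l) a l].

Lemma upd_in n (i : midx n) k (a : 'I_(n k)) : upd i a k = a.
Proof. by rewrite ffunE dfwith_in. Qed.

Lemma upd_out n (i : midx n) k (a : 'I_(n k)) l : l != k -> upd i a l = i l.
Proof. by move=> lk; rewrite ffunE dfwith_out// eq_sym. Qed.

Lemma upd_eq n (i j : midx n) k (a : 'I_(n k)) :
  j k = a -> (forall l, l != k -> j l = i l) -> j = upd i a.
Proof.
move=> jk jl; apply/ffunP => l; have [->|lk] := eqVneq l k.
  by rewrite upd_in.
by rewrite upd_out// jl.
Qed.

Lemma upd_id n (i : midx n) k : upd i (i k) = i.
Proof. by apply/esym/upd_eq. Qed.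

Lemma upd_upd n (i : midx n) k (a b : 'I_(n k)) : upd (upd i a) b = upd i b.
Proof. by apply: upd_eq => [|l lk]; rewrite ?upd_in// !upd_out. Qed.

(** The sizes may differ at [k], as they do across a mode product or a row matrix; components of
    different types are compared as natural numbers. *)
Lemma long_nat_eq n m k (i : midx n) (j : midx m) :
  (forall l, l != k -> n l = m l) ->
  (forall l, l != k -> i l = j l :> nat) -> long_nat k i = long_nat k j.
Proof.
move=> nm ij; rewrite /long_nat.
have : {subset [seq l <- enum 'I_d | l != k] <= predC1 k}.
  by move=> l; rewrite mem_filter inE => /andP[].
elim: [seq l <- enum 'I_d | l != k] 0%N => //= l s IHs a sk.
have lk : l != k by apply: sk; rewrite mem_head.
rewrite (ij _ lk) (nm _ lk) IHs// => x xs.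
by apply: sk; rewrite in_cons xs orbT.
Qed.

Lemma long_index_upd n (i : midx n) k (a : 'I_(n k)) :
  long_index k (upd i a) = long_index k i.
Proof. by apply: val_inj; apply: long_nat_eq => // l lk; rewrite upd_out. Qed.

Lemma midx_transfer n m k (i : midx n) (a : 'I_(m k)) :
  (forall l, l != k -> n l = m l) ->
  exists2 j : midx m, j k = a & forall l, l != k -> j l = i l :> nat.
Proof.
move=> nm.
have jP l : exists x : 'I_(m l),
    (l = k -> x = a :> nat) /\ (l != k -> x = i l :> nat).
  have [->|lk] := eqVneq l k; first by exists a; split.
  exists (cast_ord (nm l lk) (i l)); split=> // e.
  by case/eqP: (lk).
have {jP} [j jE] : {j : forall l, 'I_(m l) | forall l,
    (l = k -> j l = a :> nat) /\ (l != k -> j l = i l :> nat)}.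
  exists (fun l => sval (cid (jP l))) => l.
  exact: svalP (cid (jP l)).
exists [ffun l => j l]; first by apply: val_inj; rewrite ffunE; apply: (jE k).1.
by move=> l lk; rewrite ffunE (jE l).2.
Qed.

(** Mixed-radix expansion: the last mode is the least significant digit, a remainder of [b], and the
    quotient is expanded by induction. *)
Lemma long_index_surj n k (b : 'I_(\prod_(l | l != k) n l)) :
  (forall l, (0 < n l)%N) -> exists i : midx n, long_index k i = b.
Proof.
move=> n_gt0.
suff [i ib] : exists i : midx n, long_nat k i = b :> nat.
  by exists i; apply: val_inj.
have : uniq [seq l <- enum 'I_d | l != k] by rewrite filter_uniq ?enum_uniq.
have : (b < \prod_(l <- [seq l <- enum 'I_d | l != k]) n l)%N.
  rewrite big_filter big_enum_cond; apply: leq_trans (ltn_ord b) _.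
  by rewrite leq_eqVlt; apply/orP; left; apply/eqP; apply: eq_bigl.
rewrite /long_nat; move: (nat_of_ord b) => {b}.
elim/last_ind: [seq l <- enum 'I_d | l != k] => [|s l IHs] b.
  rewrite big_nil ltnS leqn0 => /eqP-> _.
  by exists [ffun l => Ordinal (n_gt0 l)].
rewrite -cats1 big_cat big_seq1 => b_lt.
rewrite cats1 rcons_uniq => /andP[ls s_uniq].
have [|//|i ib] := IHs (b %/ n l)%N; first by rewrite ltn_divLR.
exists (upd i (Ordinal (ltn_pmod b (n_gt0 l)))).
rewrite foldl_rcons upd_in /= [RHS](divn_eq b (n l)) -{}ib; congr (_ * _ + _)%N.
(* The modes in [s] differ from [l], so changing digit [l] leaves their Horner value unchanged. *)
elim: s ls 0%N {IHs b_lt s_uniq} => //= x s IHs.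
rewrite inE negb_or => /andP[lx ls] a; by rewrite upd_out ?IHs// eq_sym.
Qed.

End MultiIndex.

Section Unfolding.
Variables (F : numFieldType) (H : lmodType F) (d : nat) (n : 'I_d -> nat).
Implicit Types (A G : tensor H n) (k : 'I_d).

Lemma unfold_upd k A (i : midx n) (a : 'I_(n k)) :
  unfold k A a (long_index k i) = A (upd i a).
Proof. by rewrite -(unfoldE k A (upd i a)) upd_in long_index_upd. Qed.

Lemma rmulmx_unfold k A p (X : 'M[F]_(n k, p)) (i : midx n) x :
  rmulmx (unfold k A)^T X (long_index k i) x = \sum_a X a x *: A (upd i a).
Proof. by rewrite mxE; apply: eq_bigr => a _; rewrite mxE unfold_upd. Qed.

(** The rows of the transposed unfolding are the mode-[k] fibres; positive sizes ensure that each
    long index comes from a multi-index. *)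
Lemma rel_unfoldP (n_gt0 : forall l, (0 < n l)%N) k A p (X : 'M[F]_(n k, p)) :
  rmulmx (unfold k A)^T X = 0 <->
  forall i x, \sum_a X a x *: A (upd i a) = 0.
Proof.
split=> [AX i x|AX]; first by rewrite -rmulmx_unfold AX mxE.
apply/matrixP => b x; have [i <-] := long_index_surj b n_gt0.
by rewrite rmulmx_unfold AX mxE.
Qed.

(** Each mode-[k] fibre has exactly one member with component [a] at [k], which serves as its
    representative. *)
Lemma sum_slices (V : nmodType) k (a : 'I_(n k)) (E : midx n -> V) :
  \sum_(j : midx n) E j =
  \sum_(j : midx n | j k == a) \sum_(b : 'I_(n k)) E (upd j b).
Proof.
rewrite (partition_big (fun j => upd j a) (fun j => j k == a)) /=; last first.
  by move=> j _; rewrite upd_in.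
apply: eq_bigr => j /eqP jk.
rewrite (reindex_onto (fun b => upd j b) (fun i => i k)) /=.
  apply: eq_bigl => b; rewrite upd_in eqxx andbT upd_upd -{1}jk upd_id.
  exact: eqxx.
by move=> i /eqP <-; rewrite upd_upd upd_id.
Qed.

(** Full multilinear contraction, one vector per mode. An entry of a Tucker product contracts the
    core with a row of each factor, so this form treats all modes symmetrically. *)
Definition contract (c : forall l, 'I_(n l) -> F) G : H :=
  \sum_(j : midx n) (\prod_l c l (j l)) *: G j.

Lemma contractD1 k (c : forall l, 'I_(n l) -> F) G :
  contract c G =
  \sum_(j : midx n) (c k (j k) * \prod_(l | l != k) c l (j l)) *: G j.
Proof. by apply: eq_bigr => j _; rewrite (bigD1 k). Qed.

(** Grouped by mode-[k] fibres, the contraction depends on [c k] only through the fibre sums of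
    [G]. *)
Lemma contract_eq1 k (c c' : forall l, 'I_(n l) -> F) G :
  (forall l, l != k -> c l =1 c' l) ->
  (forall j, \sum_a c k a *: G (upd j a) = \sum_a c' k a *: G (upd j a)) ->
  contract c G = contract c' G.
Proof.
move=> cc' cGc'G; rewrite !(contractD1 k).
(* [sum_slices] needs a component in mode [k]; if there is none, there is no multi-index either. *)
have [nk|nk] := posnP (n k).
  by apply: eq_bigr => j _; have := ltn_ord (j k); rewrite {2}nk.
rewrite !(sum_slices (Ordinal nk)); apply: eq_bigr => j _.
have slice (e : forall l, 'I_(n l) -> F) :
    \sum_(b : 'I_(n k))
      (e k (upd j b k) * \prod_(l | l != k) e l (upd j b l)) *: G (upd j b)
    = (\prod_(l | l != k) e l (j l)) *: \sum_b e k b *: G (upd j b).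
  rewrite scaler_sumr; apply: eq_bigr => b _; rewrite upd_in scalerA mulrC.
  by congr (_ * _ *: _); apply: eq_bigr => l lk; rewrite upd_out.
rewrite !slice cGc'G; congr (_ *: _); apply: eq_bigr => l lk; exact: cc'.
Qed.

Lemma contract_eq (c c' : forall l, 'I_(n l) -> F) G :
  (forall l j, \sum_a c l a *: G (upd j a) = \sum_a c' l a *: G (upd j a)) ->
  contract c G = contract c' G.
Proof.
move=> cc'.
(* The vectors are exchanged one mode at a time; [s] lists the modes already exchanged. *)
have hybrid (s : seq 'I_d) :
    contract c G = contract (fun l => if l \in s then c' l else c l) G.
  elim: s => [//|k s ->]; apply: (@contract_eq1 k) => [l lk|j].
    by rewrite inE (negbTE lk).
  by rewrite mem_head; case: ifP => _.
rewrite (hybrid (enum 'I_d)); apply: eq_bigr => j _; congr (_ *: _).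
by apply: eq_bigr => l _; rewrite mem_enum.
Qed.

Lemma contract0 k (c : forall l, 'I_(n l) -> F) G :
  (forall a, c k a = 0) -> contract c G = 0.
Proof.
by move=> c0; rewrite (contractD1 k) big1// => j _; rewrite c0 mul0r scale0r.
Qed.

Lemma contract_delta_but k (c : forall l, 'I_(n l) -> F) G (i : midx n) :
  (forall l, l != k -> forall a, c l a = (a == i l)%:R) ->
  contract c G = \sum_a c k a *: G (upd i a).
Proof.
move=> cE; rewrite (contractD1 k) (sum_slices (i k)) (bigD1 i)//=.
rewrite [X in _ + X]big1.
  rewrite addr0; apply: eq_bigr => b _; rewrite upd_in big1 ?mulr1// => l lk.
  by rewrite cE// upd_out// eqxx.
move=> j /andP[/eqP jk ji]; rewrite big1// => b _.
have [l /andP[lk jil]] : exists l, (l != k) && (j l != i l).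
  apply/existsP; apply: contraNT ji; rewrite negb_exists => /forallP ij.
  apply/eqP/ffunP => l; have [->//|lk] := eqVneq l k.
  by have := ij l; rewrite lk /= negbK => /eqP.
rewrite (bigD1 l)// (cE l lk) (upd_out j b lk) /= (negbTE jil).
by rewrite mul0r mulr0 scale0r.
Qed.

Lemma contract_delta k G (i : midx n) :
  contract (fun l a => (a == i l)%:R) G = G i.
Proof.
rewrite (@contract_delta_but k _ _ i)// (bigD1 (i k))//= eqxx scale1r upd_id.
by rewrite big1 ?addr0// => a /negbTE->; rewrite scale0r.
Qed.

End Unfolding.

(** * Tucker products and subtensors *)

Section Tucker.
Variables (F : numFieldType) (H : lmodType F) (d : nat).
Implicit Types (n m : 'I_d -> nat) (k : 'I_d).

(** [h a] plays the part of [upd i a], which cannot be formed here: [i] and the indices of [A] may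
    have different sizes in mode [k]. *)
Lemma mode_prodE n m k (eq_mn : forall l, l != k -> m l = n l) (A : tensor H n)
    (B : 'M[F]_(m k, n k)) (i : midx m) (h : 'I_(n k) -> midx n) :
  (forall a, h a k = a) -> (forall a l, l != k -> h a l = i l :> nat) ->
  mode_prod eq_mn A B i = \sum_a B (i k) a *: A (h a).
Proof.
move=> hk hl; rewrite ffunE mxE; apply: eq_bigr => a _; congr (_ *: _).
rewrite -(unfoldE k A (h a)) hk; congr (unfold k A a _); apply: val_inj => /=.
by apply: long_nat_eq => // l lk; rewrite hl.
Qed.

(* Natural-number indices spare casts between the successive tensor sizes. *)
Definition nat_entry p q (B : 'M[F]_(p, q)) (x y : nat) : F :=
  oapp (fun a => oapp (B a) 0 (insub y)) 0 (insub x).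

Lemma nat_entryE p q (B : 'M[F]_(p, q)) (a : 'I_p) (b : 'I_q) :
  nat_entry B a b = B a b.
Proof. by rewrite /nat_entry !valK. Qed.

Lemma nat_entry_cast p q p' q' (e : (p = p') * (q = q')) (B : 'M[F]_(p, q))
    (a : 'I_p') (b : 'I_q') :
  castmx e B a b = nat_entry B a b.
Proof. by rewrite castmxE -nat_entryE. Qed.

Section Formula.
Variables (n m : 'I_d -> nat) (A : tensor H n) (B : forall l, 'M[F]_(m l, n l)).

(** Modes not yet multiplied carry a delta vector. In the induction step the delta of mode [t]
    collapses the sum in the new mode product to a single entry of [B]. *)
Lemma tucker_uptoE t (td : (t <= d)%N) (i : midx (mixed_dims n m t)) :
  tucker_upto A B td i =
  contract (fun l b => if (l < t)%N then nat_entry (B l) (i l) b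
                       else (i l == b :> nat)%:R) A.
Proof.
elim: t td i => [|t IHt] td i /=.
  rewrite /contract (bigD1 i)//= big1 ?scale1r => [|l _]; last by rewrite eqxx.
  rewrite big1 ?addr0// => j ji.
  have [l jil] : exists l, i l != j l.
    apply/existsP; apply: contraNT ji; rewrite negb_exists => /forallP ij.
    by apply/eqP/ffunP => l; apply/esym/eqP; rewrite -[_ == _]negbK ij.
  by rewrite (bigD1 l)//= val_eqE (negbTE jil) mul0r scale0r.
set k := Ordinal td.
have [h hP] :
    {h : 'I_(mixed_dims n m t k) -> midx (mixed_dims n m t) | forall a,
    h a k = a /\ forall l, l != k -> h a l = i l :> nat}.
  have hP a := midx_transfer i a (@mixed_dims_other d n m t td).
  exists (fun a => s2val (cid2 (hP a))) => a.
  by split; [exact: s2valP (cid2 (hP a))|exact: s2valP' (cid2 (hP a))].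
rewrite (@mode_prodE _ _ _ _ _ _ _ h); last 2 first.
- by move=> a; case: (hP a).
- by move=> a; case: (hP a).
under eq_bigr do rewrite IHt scaler_sumr.
rewrite exchange_big; apply: eq_bigr => j _ /=.
under eq_bigr do rewrite scalerA.
rewrite -scaler_suml; congr (_ *: _).
rewrite [RHS](bigD1 k)//= ltnSn.
under eq_bigr => a _.
  rewrite (bigD1 k)//= ltnn (hP a).1 nat_entry_cast mulrA.
  rewrite [X in _ * X](_ : _ = \prod_(l | l != k) if (l < t.+1)%N
      then nat_entry (B l) (i l) (j l) else (i l == j l :> nat)%:R).
    over.
  apply: eq_bigr => l lk; rewrite (hP a).2// ltnS [in RHS]leq_eqVlt.
  by move: lk; rewrite -val_eqE /= => /negbTE->.
rewrite -mulr_suml; congr (_ * _).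
have nk : n k = mixed_dims n m t k by rewrite /mixed_dims ltnn.
rewrite (bigD1 (cast_ord nk (j k)))//= eqxx mulr1 big1 ?addr0// => a.
by rewrite -val_eqE /= => /negbTE->; rewrite mulr0.
Qed.

Lemma tuckerE (i : midx m) : tucker A B i = contract (fun l => B l (i l)) A.
Proof.
rewrite ffunE tucker_uptoE; apply: eq_bigr => j _; congr (_ *: _).
by apply: eq_bigr => l _; rewrite ltn_ord ffunE -nat_entryE.
Qed.

End Formula.

Section Subtensor.
Variables (n : 'I_d -> nat) (A : tensor H n) (I : forall l, {set 'I_(n l)}).
Hypothesis I_neq0 : forall l, I l != set0.

Definition embed (i : midx (fun l => #|I l|)) : midx n :=
  [ffun l => enum_val (i l)].

Lemma subtensorE i : subtensor A I i = A (embed i).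
Proof. by rewrite ffunE. Qed.

Lemma embed_upd k (i : midx (fun l => #|I l|)) (a : 'I_#|I k|) :
  embed (upd i a) = upd (embed i) (enum_val a).
Proof.
apply: upd_eq => [|l lk]; first by rewrite ffunE upd_in.
by rewrite [LHS]ffunE [RHS]ffunE upd_out.
Qed.

Lemma card_index_gt0 l : (0 < #|I l|)%N.
Proof. by rewrite card_gt0. Qed.

Lemma dim_gt0 l : (0 < n l)%N.
Proof. by rewrite -[n l]card_ord (leq_trans (card_index_gt0 l))// max_card. Qed.

(** Away from [k], the sets [colon k I l] and [I l] are equal only by a proof, so members of the two
    index types are matched by their values. *)
Lemma enum_val_nat_eq p (X Y : {set 'I_p}) (x : 'I_#|X|) (y : 'I_#|Y|) :
  X = Y -> x = y :> nat -> enum_val x = enum_val y.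
Proof. by move=> XY; case: Y / XY y => y /val_inj->. Qed.

Lemma enum_val_setT p (X : {set 'I_p}) (x : 'I_#|X|) (y : 'I_p) :
  X = [set: 'I_p] -> x = y :> nat -> enum_val x = y.
Proof.
move=> XT; case: _ / (esym XT) x => x xy.
by rewrite (enum_val_nth y) enum_setT -enumT xy nth_ord_enum.
Qed.

Lemma rowsE k (i : midx (fun l => #|I l|)) (a : 'I_(n k)) :
  rows k A I (long_index k i) a = A (upd (embed i) a).
Proof.
(* [j] indexes the subtensor with full mode [k]: it has component [a] there and agrees with [i]
   elsewhere. *)
have [|j jk jl] := @midx_transfer d (fun l => #|I l|)
    (fun l => #|colon k I l|) k i
    (cast_ord (esym (card_colon k I)) a).
  by move=> l lk; rewrite /colon dfwith_out // eq_sym.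
rewrite castmxE [LHS]mxE.
have -> : cast_ord (esym (prod_card_colon k I)) (long_index k i) =
          long_index k j.
  apply: val_inj; apply: long_nat_eq => l lk; last by rewrite jl.
  by rewrite /colon dfwith_out // eq_sym.
have {1}-> : cast_ord (esym (card_colon k I)) a = j k by rewrite jk.
rewrite unfoldE ffunE; congr (A _); apply: upd_eq => [|l lk]; rewrite ffunE.
  by apply: enum_val_setT; rewrite ?jk// /colon dfwith_in.
rewrite ffunE; apply: enum_val_nat_eq; last exact: jl.
by rewrite /colon dfwith_out // eq_sym.
Qed.

Lemma mx_row_eq k p (X Y : 'M[H]_(\prod_(l | l != k) #|I l|, p)) :
  (forall (i : midx (fun l => #|I l|)) a,
    X (long_index k i) a = Y (long_index k i) a) -> X = Y.
Proof.
move=> XY; apply/matrixP => b a.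
by have [i <-] := long_index_surj b card_index_gt0.
Qed.

(** Written as a matrix factor, restriction to [I k] composes with [pinv_mulr] and the rank
    lemmas. *)
Definition selection k : 'M[F]_(n k, #|I k|) := colsub enum_val 1%:M.

Lemma rmulmx_selection k p (X : 'M[H]_(p, n k)) :
  rmulmx X (selection k) = colsub enum_val X.
Proof.
apply/matrixP => i j; rewrite !mxE (bigD1 (enum_val j))//= !mxE eqxx scale1r.
by rewrite big1 ?addr0// => a /negbTE aj; rewrite !mxE aj scale0r.
Qed.

Lemma unfold_subtensor k :
  (unfold k (subtensor A I))^T = rmulmx (rows k A I) (selection k).
Proof.
rewrite rmulmx_selection; apply: mx_row_eq => i a.
by rewrite [LHS]mxE unfold_upd subtensorE embed_upd [RHS]mxE rowsE.
Qed.

(** Each row of the row matrix is also a row of the transposed unfolding. *)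
Lemma rel_rows k p (X : 'M[F]_(n k, p)) :
  rmulmx (unfold k A)^T X = 0 -> rmulmx (rows k A I) X = 0.
Proof.
move=> /(rel_unfoldP dim_gt0) AX; apply: mx_row_eq => i x.
rewrite [RHS]mxE -(AX (embed i) x) mxE.
by apply: eq_bigr => a _; rewrite rowsE.
Qed.

(** The vector built from [g l] is its extension by zero outside [I l], so only the entries of [A]
    in the index box contribute. *)
Lemma contract_subtensor (g : forall l, 'I_#|I l| -> F) :
  contract (fun l y => \sum_a selection l y a * g l a) A =
  contract g (subtensor A I).
Proof.
have selE l y a : selection l y a = (y == enum_val a)%:R by rewrite !mxE.
rewrite /contract (bigID (fun y : midx n => [forall l, y l \in I l]))/=.
rewrite [X in _ + X]big1 ?addr0 => [|y]; last first.
  rewrite negb_forall => /existsP[l yl]; 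
  rewrite (bigD1 l)//= big1 ?mul0r ?scale0r// => a _.
  rewrite selE; case: eqP => [ya|]; last by rewrite mul0r.
  by rewrite ya enum_valP in yl.
(* [rank] inverts [embed] on the box; [a0] supplies the member of [I l] that [enum_rank_in]
   requires. *)
pose a0 l := Ordinal (card_index_gt0 l).
pose rank y := [ffun l => enum_rank_in (enum_valP (a0 l)) (y l)].
rewrite (reindex_onto embed rank).
  apply: eq_big => [i|i _].
    apply/andP; split; first by apply/forallP => l; rewrite ffunE enum_valP.
    by apply/eqP/ffunP => l; rewrite !ffunE enum_valK_in.
  rewrite subtensorE; congr (_ *: _); apply: eq_bigr => l _.
  rewrite (bigD1 (i l))//= selE ffunE eqxx mul1r big1 ?addr0// => a.
  by rewrite selE (inj_eq enum_val_inj) eq_sym => /negbTE->; rewrite mul0r.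
move=> y /forallP yI; apply/ffunP => l; rewrite !ffunE.
exact: enum_rankK_in (yI l).
Qed.

End Subtensor.
End Tucker.

(** * Tucker-cross approximation *)

Section TuckerCross.
Variables (R : realType) (f : scalar_kind).
Local Notation F := (scalar_field R f).
Variables (H : completeNormedModType F) (ip : {dot H for @conj_scalar R f}).
Variables (d : nat) (n : 'I_d -> nat) (A : tensor H n).
Variables (I : forall l, {set 'I_(n l)}) (I_neq0 : forall l, I l != set0).

Local Notation G := (subtensor A I).
Local Notation B := (crossT ip A I).
Local Notation P k := (colwise (pinv ip (unfold k G)^T) (rows k A I)).

Lemma factor_selection k :
  P k *m selection _ I k = colwise (pinv ip (unfold k G)^T) (unfold k G)^T.
Proof. by rewrite unfold_subtensor// -pinv_mulr -unfold_subtensor. Qed.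

(** Entrywise form of [M_k M_k^+ M_k = M_k]: on the fibres of [G], a column of [P k] with index in
    [I k] acts as a delta. *)
Lemma factor_fix k (j : midx (fun l => #|I l|)) (a : 'I_#|I k|) :
  \sum_b P k b (enum_val a) *: G (upd j b) = G (upd j a).
Proof.
have := mul_pinv_id ip (unfold k G)^T; rewrite -factor_selection.
rewrite -rmulmxA rmulmx_selection.
move=> /(congr1 (fun X : 'M_(_, _) => X (long_index k j) a)).
by rewrite [LHS]mxE rmulmx_unfold [RHS]mxE unfold_upd.
Qed.

Lemma crossTE (i : midx n) : B i = contract (fun l b => P l b (i l)) G.
Proof.
rewrite [LHS]tuckerE; apply: eq_bigr => j _; congr (_ *: _).
by apply: eq_bigr => l _; rewrite [LHS]mxE.
Qed.

(** In the modes other than [k] the index lies in the box, where [factor_fix] replaces the factor by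
    a delta; only the factor of mode [k] survives. *)
Lemma crossT_slice k (j : midx (fun l => #|I l|)) x :
  B (upd (embed j) x) = \sum_b P k b x *: G (upd j b).
Proof.
rewrite crossTE.
pose c l b := if l == k then P l b (upd (embed j) x l) else (b == j l)%:R.
rewrite (@contract_eq _ _ _ _ _ c).
  rewrite (@contract_delta_but _ _ _ _ k _ _ j) => [|l lk b].
    by apply: eq_bigr => b _; rewrite /c eqxx upd_in.
  by rewrite /c (negbTE lk).
move=> l j'; rewrite /c; have [->//|lk] := eqVneq l k.
rewrite upd_out// [embed j l]ffunE factor_fix.
rewrite (bigD1 (j l))//= eqxx scale1r big1 ?addr0// => b /negbTE->.
by rewrite scale0r.
Qed.

Lemma rows_crossT k : rows k B I = rmulmx (unfold k G)^T (P k).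
Proof.
apply: mx_row_eq => // j x.
by rewrite rowsE crossT_slice rmulmx_unfold.
Qed.

Lemma subtensor_crossT : (0 < d)%N -> subtensor B I = G.
Proof.
move=> d0; apply/ffunP => j; pose k := Ordinal d0.
rewrite subtensorE -(upd_id (embed j) k) crossT_slice ffunE factor_fix.
by rewrite upd_id.
Qed.

(** Together with [col_rank_rows_le], this places the rank of the row matrix between those of two
    unfoldings. The tensor [T] is arbitrary because both [A] and [B] are needed. *)
Lemma row_rank_subtensor_le_rows (T : tensor H n) k :
  (row_rank (unfold k (subtensor T I)) <= col_rank (rows k T I))%N.
Proof.
rewrite /row_rank unfold_subtensor//.
by apply: (col_rank_le (W := selection _ I k)) => e; rewrite rmulmxA.
Qed.

Lemma col_rank_rows_le (T : tensor H n) k :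
  (col_rank (rows k T I) <= row_rank (unfold k T))%N.
Proof.
by apply: (col_rank_le (W := 1%:M)) => e; rewrite mul1mx; exact: rel_rows.
Qed.

(** Contracting [B] with [e] in mode [k] amounts to contracting [G] with [P k *m e] there. If the
    latter is a relation of the fibres of [G], then [e] is one for [B]. *)
Lemma row_rank_crossT_le k : (row_rank (unfold k B) <= row_rank (unfold k G))%N.
Proof.
apply: (col_rank_le (W := P k)) => e.
move=> /(rel_unfoldP (card_index_gt0 I_neq0)) Ge.
apply/(rel_unfoldP (dim_gt0 I_neq0)) => i x.
have -> : \sum_a e a x *: B (upd i a) = contract (fun l => dfwith
    (fun l b => P l b (i l)) (fun b => (P k *m e) b x : F) l) G.
  under [LHS]eq_bigr do rewrite crossTE (contractD1 k) scaler_sumr.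
  rewrite (contractD1 k) exchange_big; apply: eq_bigr => j _ /=.
  under [LHS]eq_bigr do rewrite scalerA.
  rewrite -scaler_suml dfwith_in mxE mulr_suml; congr (_ *: _).
  apply: eq_bigr => a _; rewrite upd_in mulrA (mulrC (e a x)); congr (_ * _).
  by apply: eq_bigr => l lk; rewrite upd_out// dfwith_out// eq_sym.
(* By [Ge], the vector [P k *m e] has the same effect on the fibres of [G] as zero. *)
transitivity (contract (fun l => dfwith
    (fun l b => P l b (i l) : F) (fun _ : 'I_#|I k| => 0) l) G).
  apply: (@contract_eq1 _ _ _ _ k) => [l lk a|j].
    by rewrite !dfwith_out// eq_sym.
  by rewrite !dfwith_in Ge big1// => b _; rewrite scale0r.
by rewrite (@contract0 _ _ _ _ k)// => a; rewrite dfwith_in.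
Qed.

End TuckerCross.

Theorem theorem3p4 (R : realType) (f : scalar_kind)
    (H : completeNormedModType (scalar_field R f))
    (ip : {dot H for @conj_scalar R f})
    (ip_norm : forall x : H, ip x x = `|x| ^+ 2)
    (d : nat) (d_ge2 : (2 <= d)%N) (n : 'I_d -> nat)
    (A : tensor H n) (A_neq0 : A != 0)
    (I : forall k, {set 'I_(n k)}) (I_neq0 : forall k, I k != set0) :
  let G := subtensor A I in
  let Rows := fun k => rows k A I in
  let B := crossT ip A I in
  [/\ subtensor B I = G /\ rankT B = rankT G,
      forall k, rows k B I = Rows k <->
                row_rank (unfold k G) = col_rank (Rows k)
    & B = A <-> rankT G = rankT A].
Proof.
move=> G Rows B; have d_gt0 : (0 < d)%N by exact: ltnW.
have BG : subtensor B I = G by exact: subtensor_crossT.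
have rankBG : rankT B = rankT G.
  apply: eq_mktuple => k; apply/eqP; rewrite eqn_leq row_rank_crossT_le// -BG.
  (* The reverse bound: [G] is the subtensor of [B]. *)
  exact: leq_trans (row_rank_subtensor_le_rows _ _ _) (col_rank_rows_le _ _ _).
have rowsP k :
    rows k B I = Rows k <-> row_rank (unfold k G) = col_rank (Rows k).
  split=> [RBE|rankR].
    apply/eqP; rewrite eqn_leq row_rank_subtensor_le_rows//= -RBE rows_crossT//.
    exact: col_rank_rmulmx.
  (* Equal ranks give [R_k = M_k Y], and [M_k M_k^+] fixes every matrix of this form. *)
  have [|Y RE] := @span_eq_of_rank _ _ _ _ _ (Rows k) (selection _ I k).
    by rewrite -unfold_subtensor.
  rewrite rows_crossT// -/(Rows k) RE -unfold_subtensor// pinv_mulr.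
  by rewrite -rmulmxA mul_pinv_id.
split=> //; split=> [<-//|rankGA].
have rankGk k : row_rank (unfold k G) = row_rank (unfold k A).
  by have := congr1 (fun t => tnth t k) rankGA; rewrite !tnth_mktuple.
(* The rank of [Rows k] lies between those of the unfoldings of [G] and [A], which coincide. *)
have rankRk k : col_rank (Rows k) = row_rank (unfold k A).
  apply/eqP; rewrite eqn_leq col_rank_rows_le// -rankGk.
  exact: row_rank_subtensor_le_rows.
pose P k := colwise (pinv ip (unfold k G)^T) (Rows k).
have RP k : rmulmx (Rows k) (1%:M - selection _ I k *m P k) = 0.
  have /rowsP : row_rank (unfold k G) = col_rank (Rows k) by rewrite rankRk.
  rewrite rmulmxBr rmulmx1 -rmulmxA -unfold_subtensor// => <-.
  by rewrite rows_crossT// subrr.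
have AP k : rmulmx (unfold k A)^T (1%:M - selection _ I k *m P k) = 0.
  apply: rel_eq_of_rank (RP k) => [e|]; first exact: rel_rows.
  exact/esym/rankRk.
(* Both entries become contractions of [A]: on the left with columns of [selection _ I l *m P l], on
   the right with deltas. By [AP] these vectors agree on every fibre of [A]. *)
apply/ffunP => i; rewrite crossTE -contract_subtensor//.
rewrite -[RHS](contract_delta (Ordinal d_gt0)); apply: contract_eq => l j.
apply/esym/subr0_eq; rewrite -sumrB.
have /(rel_unfoldP (dim_gt0 I_neq0))/(_ j (i l)) := AP l.
by apply: etrans; apply: eq_bigr => a _; rewrite -scalerBl !mxE.
Qed.
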